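(* Let $(P,r(P))$ be a generic axis-aligned pair, where $P=(P_1,\dots,P_n)$ consists of $n$ points on a line $l\neq l_0$ parallel to $l_0$. Suppose that the iterate $MP^{n-1}$ of the mirror pentagram map is well defined on $(P,r(P))$, and let $(S,r(S))=MP^{n-1}(P,r(P))$. Then $MP^{n-1}$ takes $(P,r(P))$ to two points $(s,r(s))\in\mathbb{P}^2\times\mathbb{P}^2$, i.e. $S_1=S_2=\cdots=S_n=s$, and $$p(s)=\mathscr C(p(P))=\frac1n\big(p(P_1)+p(P_2)+\cdots+p(P_n)\big).$$
   Context: $\mathbb{P}^2$ is the real projective plane with affine part $\mathbb{R}^2$, whose point $(x,y)$ has homogeneous coordinates $(X,Y,Z)=(x,1,y)$. $l_0$ is the projective line whose affine part is the $x$-axis. The reflection $r:\mathbb{P}^2\to\mathbb{P}^2$ is $(X,Y,Z)\mapsto(X,Y,-Z)$, i.e. $(x,y)\mapsto(x,-y)$ on $\mathbb{R}^2$; write $X'=r(X)$. The projection $p:\mathbb{P}^2\dashrightarrow\mathbb{P}^1$ is $(X,Y,Z)\mapsto(X,Y)$, i.e. $p(x,y)=x$ on $\mathbb{R}^2$. Both are applied entrywise to tuples. For $B=(B_1,\dots,B_n)\in\mathbb{R}^n$ put $\mathscr C(B)=\frac1n\sum_i B_i$. The mirror pentagram map $MP$: for a linearly ordered sequence $P=(X_1,\dots,X_n)$ of points of $\mathbb{P}^2$ (indices mod $n$), $MP$ sends $(P,r(P))$ to $(Q,r(Q))$, where $Q=(Y_1,\dots,Y_n)$ with $$Y_i=X_iX_{i+1}'\cap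 X_{i-1}X_i' ,\qquad\text{and so}\qquad Y_i'=r(Y_i)=X_i'X_{i+1}\cap X_{i-1}'X_i .$$ It is well defined when each pair of points spanning a line here is distinct and each pair of lines being intersected is distinct. An axis-aligned pair is a pair $(P,r(P))$ with all points of $P$ in the affine plane on a line $l\ne l_0$ parallel to $l_0$ (a horizontal line $y=c$, $c\neq0$). ''Generic'' means: for all $P$ in some nonempty Zariski-open subset of the parameter space of such $P$. *)

(* Defs.v *)
From HB Require Import structures.
From mathcomp Require Import all_boot all_order all_algebra.
From mathcomp Require Import reals.
From mathcomp Require Import mpoly.

Set Implicit Arguments.
Unset Strict Implicit.
Unset Printing Implicit Defensive.

Import Order.TTheory GRing.Theory Num.Theory.
Local Open Scope ring_scope.

Section ProjectivePlane.
Variable R : fieldType.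

(* The points of P^d are the 1-dimensional subspaces of R^(d+1); the line      *)
(* spanned by two points and the meet of two lines are the sum and the         *)
(* intersection of subspaces.                                                  *)
Definition proj (d : nat) : Type := {V : {vspace 'rV[R]_d.+1} | \dim V == 1%N}.

HB.instance Definition _ d := Choice.on (proj d).
HB.instance Definition _ d := SubType.on (proj d).

Fact point_subproof d (v : 'rV[R]_d.+1) : v != 0 -> \dim <[v]> == 1%N.
Proof. by rewrite dim_vline => ->. Qed.

Definition point d (v : 'rV[R]_d.+1) (v_neq0 : v != 0) : proj d :=
  Sub <[v]>%VS (point_subproof v_neq0).

Definition hom2 (x y : R) : 'rV[R]_3 := \row_j [:: x; 1; y]`_j.
Definition hom1 (x : R) : 'rV[R]_2 := \row_j [:: x; 1]`_j.

Fact hom2_neq0 x y : hom2 x y != 0.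
Proof.
by apply/eqP => /rowP/(_ 1); rewrite !mxE /=; apply/eqP; exact: oner_neq0.
Qed.

Fact hom1_neq0 x : hom1 x != 0.
Proof.
by apply/eqP => /rowP/(_ 1); rewrite !mxE /=; apply/eqP; exact: oner_neq0.
Qed.

Definition affine2 (x y : R) : proj 2 := point (hom2_neq0 x y).
Definition affine1 (x : R) : proj 1 := point (hom1_neq0 x).

Definition refl_mx : 'M[R]_3 := diag_mx (\row_j [:: 1; 1; -1]`_j).
Definition refl_lin : 'End('rV[R]_3) := linfun (mulmxr refl_mx).

Lemma refl_mxK : refl_mx *m refl_mx = 1%:M.
Proof.
rewrite mulmx_diag; apply/matrixP=> i j; rewrite !mxE.
by case: i => [[|[|[|//]]] lti] /=; rewrite ?mulrNN mulr1.
Qed.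

Fact refl_subproof (V : proj 2) : \dim (refl_lin @: val V) == 1%N.
Proof.
rewrite limg_dim_eq ?(valP V) //; apply/eqP; rewrite -subv0.
apply/subvP=> v; rewrite memv_cap memv_ker lfunE /= => /andP[_ /eqP v0].
by rewrite memv0 -[v]mulmx1 -refl_mxK mulmxA v0 mul0mx.
Qed.

Definition refl (V : proj 2) : proj 2 :=
  Sub (refl_lin @: val V)%VS (refl_subproof V).

(* None exactly at the centre of projection [0 : 0 : 1].                       *)
Definition proj_lin : 'Hom('rV[R]_3, 'rV[R]_2) :=
  linfun (mulmxr (pid_mx 2 : 'M[R]_(3, 2))).
Definition projection (V : proj 2) : option (proj 1) :=
  insub (proj_lin @: val V)%VS.

Lemma refl_affine2 x y : refl (affine2 x y) = affine2 x (- y).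
Proof.
apply: val_inj; rewrite /= limg_line lfunE /=; congr <[_]>%VS.
apply/rowP=> j; rewrite mul_mx_diag !mxE.
by case: j => [[|[|[|//]]] ltj] /=; rewrite ?mulr1 ?mulrN1.
Qed.

Lemma projection_affine2 x y : projection (affine2 x y) = Some (affine1 x).
Proof.
rewrite /projection /= limg_line lfunE /=.
have -> : hom2 x y *m (pid_mx 2 : 'M_(3, 2)) = hom1 x.
  apply/rowP=> j; rewrite !mxE !big_ord_recl big_ord0 !mxE /=.
  by case: j => [[|[|//]] ltj] /=; rewrite !(mulr0, mulr1, add0r, addr0).
by rewrite (insubT (fun V => \dim V == 1%N) (point_subproof (hom1_neq0 x))).
Qed.

Definition join (A B : proj 2) : {vspace 'rV[R]_3} := (val A + val B)%VS.

Section MirrorPentagram.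
Variable n : nat.
Implicit Types X : {ffun 'I_n -> proj 2}.

Definition refl_seq X : {ffun 'I_n -> proj 2} := [ffun i => refl (X i)].

Definition mirror X := (X, refl_seq X).

(* Indices are cyclic: ordS i and ord_pred i are i + 1 and i - 1 mod n.        *)
Definition MP_defined (A : {ffun 'I_n -> proj 2} * {ffun 'I_n -> proj 2}) :
    bool :=
  let: (X, X') := A in
  [forall i,
    [&& X i != X' (ordS i), X' i != X (ordS i),
        join (X i) (X' (ordS i)) != join (X (ord_pred i)) (X' i)
      & join (X' i) (X (ordS i)) != join (X' (ord_pred i)) (X i)]].

Definition MP_meet X X' (i : 'I_n) : {vspace 'rV[R]_3} :=
  (join (X i) (X' (ordS i)) :&: join (X (ord_pred i)) (X' i))%VS.

(* Only meant for mirror pairs. The default value X i of insubd is never used, *)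
(* by MP_meetE below.                                                          *)
Definition MP (A : {ffun 'I_n -> proj 2} * {ffun 'I_n -> proj 2}) :=
  let: (X, X') := A in
  if MP_defined A
  then Some (mirror [ffun i => insubd (X i) (MP_meet X X' i)])
  else None.

(* Some B exactly when MP is defined at A and at the first k - 1 iterates.     *)
Definition MP_iter (k : nat)
    (A : {ffun 'I_n -> proj 2} * {ffun 'I_n -> proj 2}) :=
  iter k (obind MP) (Some A).

End MirrorPentagram.

Lemma dim_join (A B : proj 2) : A != B -> \dim (join A B) = 2%N.
Proof.
move=> AB; apply/eqP; rewrite eqn_leq; apply/andP; split.
  have [+ _] := dimv_add_leqif (val A) (val B).
  by rewrite (eqP (valP A)) (eqP (valP B)).
rewrite ltnNge; apply: contraNN AB => le1.
have EA : (val A == join A B)%VS.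
  by rewrite eqEdim addvSl (eqP (valP A)).
have EB : (val B == join A B)%VS.
  by rewrite eqEdim addvSr (eqP (valP B)).
by rewrite -val_eqE (eqP EA) eq_sym.
Qed.

Lemma dim_meet (L M : {vspace 'rV[R]_3}) :
  \dim L = 2%N -> \dim M = 2%N -> L != M -> \dim (L :&: M)%VS = 1%N.
Proof.
move=> dL dM LM; have := dimv_sum_cap L M; rewrite dL dM.
have le3 : (\dim (L + M) <= 3)%N.
  by rewrite (leq_trans (dimvS (subvf _))) // dimvf /dim /= mul1n.
have gt2 : (2 < \dim (L + M))%N.
  rewrite ltnNge; apply: contraNN LM => le2.
  have EL : (L == L + M)%VS by rewrite eqEdim addvSl dL.
  have EM : (M == L + M)%VS by rewrite eqEdim addvSr dM.
  by rewrite (eqP EL) eq_sym.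
have -> : \dim (L + M) = 3%N by apply/eqP; rewrite eqn_leq le3 gt2.
by move=> /eqP; rewrite -[(2 + 2)%N]/(3 + 1)%N eqn_add2l => /eqP.
Qed.

Lemma MP_meetE n (X X' : {ffun 'I_n -> proj 2}) i : MP_defined (X, X') ->
  val (insubd (X i) (MP_meet X X' i)) = MP_meet X X' i.
Proof.
move=> /forallP def; rewrite insubdK //; apply/eqP/dim_meet.
- by apply: dim_join; case/and4P: (def i).
- by apply: dim_join; case/and4P: (def (ord_pred i)); rewrite ord_predK.
- by case/and4P: (def i).
Qed.

Definition axis_aligned n (x : 'rV[R]_n) (c : R) : {ffun 'I_n -> proj 2} :=
  [ffun i => affine2 (x 0 i) c].

Definition centroid n (B : 'rV[R]_n) : R := n%:R^-1 * \sum_(i < n) B 0 i.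

(* A union of nonvanishing loci of polynomials.                                *)
Definition zariski_open m (U : 'rV[R]_m -> Prop) : Prop :=
  exists F : {mpoly R[m]} -> Prop,
    forall v, U v <-> exists2 f, F f & f.@[v 0] != 0.

(* Q holds for generic (x, c) in the parameter space {(x, c) | c != 0} of      *)
(* axis-aligned pairs, an open subset of the affine space R^(n + 1).           *)
Definition generically n (Q : 'rV[R]_n -> R -> Prop) : Prop :=
  exists U : 'rV[R]_(n + 1) -> Prop,
    [/\ zariski_open U,
        exists x c, c != 0 /\ U (row_mx x c%:M)
      & forall x c, c != 0 -> U (row_mx x c%:M) -> Q x c].

End ProjectivePlane.

(* Main.v *)
(** Let [phi_j (u) = \sum_b u_b x_(j+b)] for a polynomial [u] (indices mod [n]).
    A point of the [k]-th iterate is [l : u(1) : c u(-1)], where [u] has degree at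
    most [k] and [phi_i, phi_(i-1), ..., phi_(i-k)] all take the value [l] at [u];
    such a [u] is unique up to scaling as long as the map is defined.  The step from
    [k] to [k+1] combines [u_i] with ['X u_(i+1)], and [u_(i-1)] with ['X u_i]:
    multiplication by ['X] shifts [phi] and acts on the points as the reflection.
    For [k = n - 1] the polynomial [1 + 'X + ... + 'X^(n-1)] is a solution for every
    [i], because every [phi_j] sends it to the sum of the [x_i]. *)
Require Import Defs.
From mathcomp Require Import all_boot all_order all_algebra.
From mathcomp Require Import reals.
From mathcomp Require Import mpoly ring.

Set Implicit Arguments.
Unset Strict Implicit.
Unset Printing Implicit Defensive.

Import GRing.Theory.
Local Open Scope ring_scope.

Section Collapse.
Variables (F : fieldType) (n : nat) (x : 'rV[F]_n) (c : F).
Implicit Types (i j : 'I_n) (u w : {poly F}) (l : F) (k : nat).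
Implicit Types X : {ffun 'I_n -> proj F 2}.

(** * Window functionals on polynomials *)

Definition window i u : F := \sum_(b < size u) u`_b * x 0 (iter b (@ordS n) i).

(** Padding with zero coefficients puts polynomials of different sizes under one summation range, as
    linearity requires. *)
Lemma window_widen m i u : (size u <= m)%N ->
  window i u = \sum_(b < m) u`_b * x 0 (iter b (@ordS n) i).
Proof.
move=> sz; rewrite /window (big_ord_widen _ (fun b => u`_b * x 0 (iter b _ i)) sz).
rewrite big_mkcond; apply: eq_bigr => b _; case: ltnP => // h.
by rewrite nth_default ?mul0r.
Qed.

Lemma size_lin_leq m a b u w : (size u <= m)%N -> (size w <= m)%N ->
  (size (a *: u + b *: w)%R <= m)%N.
Proof.
move=> su sw; rewrite (leq_trans (size_polyD _ _)) // geq_max.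
by rewrite (leq_trans (size_scale_leq _ _) su) (leq_trans (size_scale_leq _ _) sw).
Qed.

Lemma size_mulX_leq m u : (size u <= m)%N -> (size ('X * u)%R <= m.+1)%N.
Proof.
by move=> su; rewrite (leq_trans (size_polyMleq _ _)) // size_polyX.
Qed.

Lemma window_lin i a b u w :
  window i (a *: u + b *: w) = a * window i u + b * window i w.
Proof.
pose m := maxn (size u) (size w).
have su : (size u <= m)%N by rewrite leq_maxl.
have sw : (size w <= m)%N by rewrite leq_maxr.
have s := size_lin_leq a b su sw.
rewrite (window_widen _ s) (window_widen _ su) (window_widen _ sw).
rewrite !mulr_sumr -big_split; apply: eq_bigr => j _ /=.
by rewrite coefD !coefZ; ring.
Qed.

Lemma window_mulX i u : window i ('X * u) = window (ordS i) u.
Proof.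
have s := size_mulX_leq (leqnn (size u)).
rewrite (window_widen _ s) big_ord_recl coefXM mul0r add0r.
by apply: eq_bigr => b _; rewrite coefXM lift0 /= -iterSr.
Qed.

(** * Polynomials with equal consecutive windows *)

(** These are [k + 1] linear conditions on the [k + 2] unknowns formed by the coefficients of [u]
    and [l], so a line of solutions is the expected case. *)
Definition balanced k i u l : Prop :=
  (size u <= k.+1)%N /\
  forall a, (a <= k)%N -> window (iter a (@ord_pred n) i) u = l.

Lemma balanced_lin k i u l w m a b :
  balanced k i u l -> balanced k i w m ->
  balanced k i (a *: u + b *: w) (a * l + b * m).
Proof.
move=> [su hu] [sw hw]; split=> [|d hd]; last by rewrite window_lin hu ?hw.
exact: size_lin_leq.
Qed.

Lemma iter_ord_predS a i :
  ordS (iter a (@ord_pred n) i) = iter a (@ord_pred n) (ordS i).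
Proof.
by elim: a => //= a IH; rewrite ord_predK -IH ordSK.
Qed.

(** The run [i, ..., i - k - 1] contains two runs of length [k + 1], starting at [i] and at
    [i - 1]. *)
Lemma balanced_narrow k i u l : balanced k.+1 i u l -> (size u <= k.+1)%N ->
  balanced k i u l /\ balanced k (ord_pred i) u l.
Proof.
move=> [_ h] s; split; split=> // a ha; first by rewrite h // ltnW.
by rewrite -iterSr h.
Qed.

(** Cancelling ['X] moves the run to [i + 1, ..., i - k], which contains the runs of length [k + 1]
    starting at [i + 1] and at [i]. *)
Lemma balanced_mulX k i u l : balanced k.+1 i ('X * u) l ->
  balanced k (ordS i) u l /\ balanced k i u l.
Proof.
move=> [s h].
have su : (size u <= k.+1)%N.
  have [->|u0] := eqVneq u 0; first by rewrite size_poly0.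
  by move: s; rewrite mulrC size_mulX.
split; split=> // a ha.
  by rewrite -iter_ord_predS -window_mulX h // ltnW.
by rewrite -(h a.+1) //= window_mulX ord_predK.
Qed.

Lemma linear_form_zero (p q : F) :
  exists a b : F, (a != 0) || (b != 0) /\ a * p + b * q = 0.
Proof.
have [p0|p0] := eqVneq p 0.
  by exists 1, 0; rewrite oner_neq0 p0 mul0r mulr0 addr0.
by exists q, (- p); rewrite oppr_eq0 p0 orbT mulrC mulNr addrN.
Qed.

Lemma balanced_widen_right k i u l w m :
  balanced k i u l -> balanced k (ordS i) w m ->
  exists a b, (a != 0) || (b != 0) /\
    balanced k.+1 i (a *: u + b *: ('X * w)) (a * l + b * m).
Proof.
move=> [su hu] [sw hw].
(* All windows from [i] down to [i - k] agree for every [a] and [b]; the one at [j = i - (k + 1)]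
   imposes a single linear condition on them. *)
pose j := iter k.+1 (@ord_pred n) i.
have [a [b [ab0 e]]] := linear_form_zero (window j u - l) (window (ordS j) w - m).
exists a, b; split=> //; split.
  by apply: size_lin_leq; [exact: leqW | exact: size_mulX_leq].
move=> d; rewrite leq_eqVlt window_lin window_mulX => /orP[/eqP->|].
  by apply/eqP; rewrite -subr_eq0 -e; apply/eqP; ring.
by rewrite ltnS => hd; rewrite hu // iter_ord_predS hw.
Qed.

Lemma balanced_widen_left k i u l w m :
  balanced k (ord_pred i) u l -> balanced k i w m ->
  exists a b, (a != 0) || (b != 0) /\
    balanced k.+1 i (a *: u + b *: ('X * w)) (a * l + b * m).
Proof.
move=> [su hu] [sw hw].
(* Here the windows from [i - 1] down to [i - k - 1] agree automatically, and the one at [i] gives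
   the condition. *)
have [a [b [ab0 e]]] := linear_form_zero (window i u - l) (window (ordS i) w - m).
exists a, b; split=> //; split.
  by apply: size_lin_leq; [exact: leqW | exact: size_mulX_leq].
case=> [|d] hd; rewrite window_lin window_mulX.
  by apply/eqP; rewrite -subr_eq0 -e; apply/eqP; rewrite /=; ring.
by rewrite iterSr hu // -iterSr /= ord_predK hw.
Qed.

(** * Points attached to balanced polynomials *)

Definition lift_pt u l : 'rV[F]_3 := \row_j [:: l; u.[1]; c * u.[-1]]`_j.

Lemma lift_pt_lin u l w m a b :
  lift_pt (a *: u + b *: w) (a * l + b * m) =
  a *: lift_pt u l + b *: lift_pt w m.
Proof.
apply/rowP=> j; rewrite !mxE !hornerE.
by case: j => [[|[|[|//]]] ltj] /=; ring.
Qed.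

(** ['X] takes the value 1 at 1 and -1 at -1, so only the last coordinate changes sign. *)
Lemma lift_pt_mulX u l : lift_pt ('X * u) l = lift_pt u l *m refl_mx F.
Proof.
apply/rowP=> j; rewrite mul_mx_diag !mxE !hornerE.
by case: j => [[|[|[|//]]] ltj] /=; ring.
Qed.

Lemma refl_line (A : proj F 2) v : val A = <[v]>%VS ->
  val (refl A) = <[v *m refl_mx F]>%VS.
Proof. by move=> e; rewrite /= e limg_line lfunE. Qed.

Definition presents k i (A : proj F 2) u l : Prop :=
  [/\ balanced k i u l, val A = <[lift_pt u l]>%VS
    & forall w m, balanced k i w m -> exists a, w = a *: u].

Lemma presents_line k i A u l w m :
  presents k i A u l -> balanced k i w m -> w != 0 ->
  val A = <[lift_pt w m]>%VS.
Proof.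
move=> [bu -> unq] bw w0; have [a def_w] := unq _ _ bw.
have a0 : a != 0 by apply: contraNneq w0 => a0; rewrite def_w a0 scale0r.
have -> : lift_pt w m = a *: lift_pt u l.
  (* The common value is itself a window of the polynomial, so it scales with it. *)
  have -> : m = a * l.
    have := window_lin i a 0 u 0; rewrite scale0r mul0r !addr0 -def_w.
    by have /= -> := bw.2 0 isT; have /= -> := bu.2 0 isT.
  have := lift_pt_lin u l 0 0 a 0; rewrite def_w.
  by rewrite !scale0r mul0r !addr0.
apply/eqP; rewrite eqEsubv -!memvE; apply/andP; split; last by rewrite memvZ ?memv_line.
by rewrite -{1}[lift_pt u l](scalerK a0) memvZ ?memv_line.
Qed.

(* From two independent solutions one makes a nonzero one without leading
   coefficient and a nonzero one without constant coefficient; these give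
   X_i = X_(i-1) and X_i = X_(i+1), so both lines are the line X_i X_i'. *)
Lemma balanced_unique k X i u l w m :
  (forall j, exists v p, presents k j (X j) v p) ->
  join (X i) (refl (X (ordS i))) != join (X (ord_pred i)) (refl (X i)) ->
  u != 0 -> balanced k.+1 i u l -> balanced k.+1 i w m -> exists a, w = a *: u.
Proof.
move=> pX lines u0 bu bw.
have [v [p pi]] := pX i; have [vS [pS prS]] := pX (ordS i).
have [vP [pP prP]] := pX (ord_pred i).
have dep a b : (a != 0) || (b != 0) -> a *: u + b *: w = 0 -> exists d, w = d *: u.
  move=> + e; have [b0|b0 _] := eqVneq b 0.
    move: e; rewrite b0 scale0r addr0 orbF => /eqP.
    by rewrite scaler_eq0 (negPf u0) orbF => ->.
  exists (- (b^-1 * a)); move/eqP: e; rewrite addrC addr_eq0 => /eqP e.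
  by rewrite scaleNr -scalerA -scalerN -e scalerK.
have depK v' p' : presents k i (X i) v p -> v' != 0 -> forall w' p'',
    balanced k i v' p' -> balanced k i w' p'' -> exists d, w' = d *: v'.
  move=> [_ _ unq] v'0 w' p'' /unq[d1 e1] /unq[d2 ->].
  have d10 : d1 != 0 by apply: contraNneq v'0 => d10; rewrite e1 d10 scale0r.
  by exists (d2 / d1); rewrite e1 scalerA mulfVK.
(* If both coefficients of degree [k + 1] vanish, uniqueness at level [k] applies directly; if both
   constant terms vanish, it applies after division by ['X]. *)
have [uk|uk] := boolP ((u`_k.+1 != 0) || (w`_k.+1 != 0)); last first.
  have narrow (v' : {poly F}) : (size v' <= k.+2)%N -> v'`_k.+1 = 0 -> (size v' <= k.+1)%N.
    move=> s z; apply/leq_sizeP => j; rewrite leq_eqVlt => /orP[/eqP<- //|].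
    by move=> h; rewrite nth_default // (leq_trans s).
  move: uk; rewrite negb_or !negbK => /andP[/eqP uk /eqP wk].
  have [bu' _] := balanced_narrow bu (narrow _ bu.1 uk).
  have [bw' _] := balanced_narrow bw (narrow _ bw.1 wk).
  exact: depK bu' bw'.
have unX (v' : {poly F}) : v'`_0 = 0 -> exists v'', v' = 'X * v''.
  move=> z; have : root v' 0 by rewrite /root horner_coef0 z.
  by move/factor_theorem=> [q ->]; exists q; rewrite subr0 mulrC.
have [u_0|u_0] := boolP ((u`_0 != 0) || (w`_0 != 0)); last first.
  move: u_0; rewrite negb_or !negbK => /andP[/eqP /unX[u' eu] /eqP /unX[w' ew]].
  move: bu bw u0; rewrite eu ew => /balanced_mulX[_ bu'] /balanced_mulX[_ bw'] u0.
  have [|d ->] := depK _ _ pi _ _ _ bu' bw'; last by exists d; rewrite scalerAr.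
  by apply: contraNneq u0 => ->; rewrite mulr0.
pose z1 := w`_k.+1 *: u + (- u`_k.+1) *: w.
pose z2 := w`_0 *: u + (- u`_0) *: w.
have [/dep|z10] := eqVneq z1 0; first by apply; rewrite oppr_eq0 orbC.
have [/dep|z20] := eqVneq z2 0; first by apply; rewrite oppr_eq0 orbC.
have XiP : X i = X (ord_pred i).
  have bz1 := balanced_lin w`_k.+1 (- u`_k.+1) bu bw.
  have sz1 : (size z1 <= k.+1)%N.
    apply/leq_sizeP => j; rewrite leq_eqVlt => /orP[/eqP<-|h].
      by rewrite coefD !coefZ; ring.
    by rewrite nth_default // (leq_trans bz1.1).
  have [b1 b2] := balanced_narrow bz1 sz1; apply: val_inj.
  by rewrite (presents_line pi b1 z10) (presents_line prP b2 z10).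
have XiS : X i = X (ordS i).
  have [|z ez] := unX z2; first by rewrite coefD !coefZ; ring.
  have := balanced_lin w`_0 (- u`_0) bu bw; rewrite -/z2 ez => /balanced_mulX[b1 b2].
  have z0 : z != 0 by apply: contraNneq z20 => z0; rewrite ez z0 mulr0.
  by apply: val_inj; rewrite (presents_line pi b2 z0) (presents_line prS b1 z0).
by move: lines; rewrite -XiS -XiP eqxx.
Qed.

(** * One step of the mirror pentagram map *)

Lemma lift_pt_join A B u l w m a b :
  A != refl B -> val A = <[lift_pt u l]>%VS -> val B = <[lift_pt w m]>%VS ->
  (a != 0) || (b != 0) ->
  let v := lift_pt (a *: u + b *: ('X * w)) (a * l + b * m) in
  v != 0 /\ v \in join A (refl B).
Proof.
move=> AB eA eB ab0 /=; rewrite lift_pt_lin lift_pt_mulX.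
have := refl_line eB; set y := _ *m _ => erB.
move: eA; set z := lift_pt u l => eA; split; last first.
  by rewrite /join eA erB memv_add ?memvZ ?memv_line.
(* Since [A] and [refl B] differ, their spanning vectors are independent and no nontrivial
   combination vanishes. *)
have dim2 : \dim (<[z]> + <[y]>)%VS = 2%N by rewrite -eA -erB; apply: dim_join.
have nz (t : 'rV[F]_3) : (\dim <[t]> <= 1)%N by rewrite dim_vline leq_b1.
apply/negP => e; move: ab0; have [b0|b0 _] := eqVneq b 0.
  rewrite orbF => a0; move: e; rewrite b0 scale0r addr0 scaler_eq0 (negPf a0) /=.
  move=> /eqP z0; have := nz y; move: dim2.
  have /eqP -> : <[z]>%VS == 0%VS by rewrite -dimv_eq0 dim_vline z0 eqxx.
  by rewrite add0v => ->.
have yz : y \in <[z]>%VS.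
  move: e; rewrite addrC addr_eq0 => /eqP e.
  by rewrite -[y](scalerK b0) e memvZ // memvN memvZ ?memv_line.
have := nz z; suff <- : (<[z]> + <[y]>)%VS = <[z]>%VS by rewrite dim2.
by apply/addv_idPl; rewrite -memvE.
Qed.

(** Widening to the right gives a point of the first line and widening to the left a point of the
    second; by uniqueness the two points coincide, hence are the intersection. *)
Lemma presents_MP k X i :
  MP_defined (mirror X) -> (forall j, exists u l, presents k j (X j) u l) ->
  exists u l,
    presents k.+1 i (insubd (X i) (MP_meet X (refl_seq X) i)) u l.
Proof.
move=> def pX; have [u [l pi]] := pX i; have [uS [lS prS]] := pX (ordS i).
have [uP [lP prP]] := pX (ord_pred i).
have := forallP def i; rewrite !ffunE => /and4P[XS _ lines _].
have := forallP def (ord_pred i); rewrite !ffunE ord_predK => /and4P[PX _ _ _].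
have [bi ei _] := pi; have [bS eS _] := prS; have [bP eP _] := prP.
have [a [b [ab0 bal]]] := balanced_widen_right bi bS.
have [v0 vL] := lift_pt_join XS ei eS ab0.
have [a' [b' [ab0' bal']]] := balanced_widen_left bP bi.
have [v0' vL'] := lift_pt_join PX eP ei ab0'.
move: bal v0 vL; set w := (a *: u + _); set m := (_ * l + _) => bal v0 vL.
move: bal' v0' vL'; set w' := (a' *: _ + _); set m' := (a' * _ + _) => bal' v0' vL'.
(* The zero polynomial has only zero windows, so its value is 0 and it lifts to the zero vector. *)
have lift0 p : lift_pt 0 p != 0 -> balanced k.+1 i 0 p -> False.
  move=> /eqP nz [_ /(_ 0%N isT)] /=; rewrite /window size_poly0 big_ord0 => p0.
  apply: nz; apply/rowP=> j; rewrite !mxE -p0 !horner0 mulr0.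
  by case: j => [[|[|[|//]]] ltj].
have w0 : w != 0 by apply/eqP=> w0; rewrite w0 in v0 bal; apply: lift0 v0 bal.
have w0' : w' != 0 by apply/eqP=> w0'; rewrite w0' in v0' bal'; apply: lift0 v0' bal'.
have unq p q : balanced k.+1 i p q -> exists d, p = d *: w.
  exact: balanced_unique pX lines w0 bal.
exists w, m; split=> //.
(* The point spanned by [lift_pt w m] is presented by [w], so [w'] must span it too. *)
have pw : presents k.+1 i (point v0) w m by split.
have eq_ww' : <[lift_pt w m]>%VS = <[lift_pt w' m']>%VS.
  exact: presents_line pw bal' w0'.
have dm := MP_meetE i def; rewrite -/(refl_seq X) in dm; rewrite dm.
symmetry; apply/eqP; rewrite eqEdim subv_cap !ffunE -memvE vL eq_ww' -memvE vL' /=.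
have := valP (insubd (X i) (MP_meet X (refl_seq X) i)).
by rewrite dm /MP_meet !ffunE => /eqP ->; rewrite dim_vline v0'.
Qed.

(** * Induction along the iterates *)

Lemma presents_axis_aligned i :
  exists u l, presents 0 i (axis_aligned x c i) u l.
Proof.
have win u : (size u <= 1)%N -> window i u = u`_0 * x 0 i.
  by move=> s; rewrite (window_widen _ s) big_ord_recl big_ord0 addr0.
(* The constant 1 with value [x_i] lifts to [[x_i : 1 : c]]. *)
exists 1, (x 0 i); split.
- split; first by rewrite size_poly1.
  by case=> // _; rewrite win ?size_poly1 // coef1 mul1r.
- rewrite ffunE /=; congr <[_]>%VS; apply/rowP=> j; rewrite !mxE !hornerE.
  by case: j => [[|[|[|//]]] ltj].
- by move=> w m [s _]; exists w`_0; rewrite {1}(size1_polyC s) alg_polyC.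
Qed.

Lemma presents_MP_iter k S S' :
  MP_iter k (mirror (axis_aligned x c)) = Some (S, S') ->
  S' = refl_seq S /\ forall i, exists u l, presents k i (S i) u l.
Proof.
rewrite /MP_iter; elim: k S S' => [|k IH] S S' /=.
  by case=> <- <-; split=> // i; apply: presents_axis_aligned.
case: (iter k _ _) IH => [[X X']|//] /(_ _ _ erefl)[-> pX] /=.
case: ifP => // def [<- <-]; split=> // i; rewrite ffunE.
exact: presents_MP def pX.
Qed.

(** * Collapse to the centroid *)

Lemma sum_iter_ordS (f : 'I_n -> F) i :
  \sum_(b < n) f (iter b (@ordS n) i) = \sum_(b < n) f b.
Proof.
have it b : val (iter b (@ordS n) i) = ((i + b) %% n)%N.
  elim: b => [|b IH] /=; first by rewrite addn0 modn_small.
  by rewrite IH -addn1 modnDml addn1 addnS.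
rewrite [RHS](reindex_inj (h := fun b : 'I_n => iter b (@ordS n) i)) //.
move=> b d /(congr1 val); rewrite /= !it => /eqP; rewrite eqn_modDl => /eqP.
by rewrite !modn_small // => /val_inj.
Qed.

Lemma balanced_sumX (hn : (0 < n)%N) i :
  balanced n.-1 i (\sum_(b < n) 'X^b) (\sum_(b < n) x 0 b).
Proof.
have -> : \sum_(b < n) 'X^b = \poly_(b < n) (1 : F).
  by rewrite poly_def; apply: eq_bigr => b _; rewrite scale1r.
have s := size_poly n (fun=> 1 : F).
split=> [|a _]; first by rewrite prednK.
rewrite (window_widen _ s) -(sum_iter_ordS (x 0) (iter a (@ord_pred n) i)).
by apply: eq_bigr => b _; rewrite coef_poly ltn_ord mul1r.
Qed.

Lemma collapse (hn : n%:R != 0 :> F) S S' :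
  MP_iter n.-1 (mirror (axis_aligned x c)) = Some (S, S') ->
  exists s : proj F 2,
    [/\ forall i, S i = s, forall i, S' i = refl s
      & projection s = Some (affine1 (centroid x))].
Proof.
move=> /presents_MP_iter[-> pS].
have n_gt0 : (0 < n)%N by rewrite lt0n; apply: contraNneq hn => ->.
pose w : {poly F} := \sum_(b < n) 'X^b.
have w1 : w.[1] = n%:R.
  rewrite horner_sum (eq_bigr (fun=> 1)) ?sumr_const ?card_ord // => b _.
  by rewrite hornerXn expr1n.
have w0 : w != 0 by apply: contraNneq hn => w0; rewrite -w1 w0 horner0.
(* The lift [[sum of the x_i : n : c w(-1)]] of [w] divided by [n]; it does not depend on [i]. *)
pose s := affine2 (centroid x) (c * w.[-1] / n%:R).
have eS i : S i = s.
  have [u [l pu]] := pS i; apply: val_inj.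
  rewrite (presents_line pu (balanced_sumX n_gt0 i) w0) /=.
  rewrite [X in <[X]>%VS](_ : _ = n%:R *: hom2 (centroid x) (c * w.[-1] / n%:R)).
    apply/eqP; rewrite eqEsubv -!memvE memvZ ?memv_line //=.
    by rewrite -{1}[hom2 _ _](scalerK hn) memvZ ?memv_line.
  apply/rowP=> j; rewrite !mxE -/w w1 /centroid.
  case: j => [[|[|[|//]]] ltj] /=; last by field.
    by rewrite mulVKf.
  by rewrite mulr1.
exists s; split=> // [i|]; first by rewrite ffunE eS.
exact: projection_affine2.
Qed.

End Collapse.

Theorem theorem4p4 (R : realType) (n : nat) (hn : (0 < n)%N) :
  generically (fun (x : 'rV[R]_n) (c : R) =>
    forall S S' : {ffun 'I_n -> proj R 2},
      MP_iter n.-1 (mirror (axis_aligned x c)) = Some (S, S') ->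
      exists s : proj R 2,
        [/\ forall i, S i = s,
            forall i, S' i = refl s
          & projection s = Some (affine1 (centroid x))]).
Proof.
(* The whole space serves as the open set, being the nonvanishing locus of the constant polynomial
   1. *)
exists (fun=> True); split.
- exists (fun f => f = 1) => v; split=> // _.
  by exists 1; rewrite // meval1 oner_neq0.
- by exists 0, 1; rewrite oner_neq0.
- move=> x c _ _ S S'; apply: collapse.
  by rewrite Num.Theory.pnatr_eq0 -lt0n.
Qed.
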